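(* Let $p$ be an odd prime and let $H,N$ be integers with $0\le H<H+N<p$. Let $d\ge 0$ be a fixed integer. For a multiplicative character $\chi$ of $\mathbb{F}_p^*$ and $f\in\mathbb{F}_p[X]$ let $$T(\chi,f,H,N)=\sum_{n=H+1}^{H+N}\chi(n!)\,\mathbf{e}(f(n)).$$ Then $$\max_{\deg f=d}\ \sum_{\chi}|T(\chi,f,H,N)|^2\ll pN^{3/2},$$ where the maximum is over all $f\in\mathbb{F}_p[X]$ of degree $d$ and the sum is over all multiplicative characters $\chi$ of $\mathbb{F}_p^*$ (including the principal one).
   Context: $\mathbb{F}_p$ is represented by $\{0,1,\dots,p-1\}$ and $\mathbf{e}(z)=\exp(2\pi i z/p)$. The implied constant may depend on $d$ but not on $p,H,N$. *)

(* Defs.v *)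
From HB Require Import structures.
From mathcomp Require Import all_boot all_order all_algebra all_fingroup all_solvable.
From mathcomp Require Import all_classical all_reals all_analysis.
From mathcomp Require Import complex.

Set Implicit Arguments.
Unset Strict Implicit.
Unset Printing Implicit Defensive.
Import Order.TTheory GRing.Theory Num.Theory.
Local Open Scope classical_set_scope.
Local Open Scope ring_scope.
Local Open Scope complex_scope.

(* exp(2 pi i z / p), written with Euler's formula. Elements of 'F_p are
   ordinals, so [z] coerces to its representative
   in {0, ..., p-1}. *)
Definition addchar (R : realType) (p : nat) (z : 'F_p) : R[i] :=
  let t := 2 * pi * z%:R / p%:R in cos t +i* sin t.

(* The values are automatically nonzero, so these are exactly the group
   homomorphisms from F_p^* to the nonzero complex numbers. *)
Definition mulchars (R : realType) (p : nat) : set {ffun {unit 'F_p} -> R[i]} :=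
  [set chi | chi 1%g = 1 /\ forall u v, chi (u * v)%g = chi u * chi v].

Lemma finite_mulchars (R : realType) (p : nat) : finite_set (@mulchars R p).
Proof.
pose G : finGroupType := {unit 'F_p}; pose P : {poly R[i]} := 'X^#|G| - 1.
have G0 : (0 < #|G|)%N by apply/card_gt0P; exists 1%g.
have P0 : P != 0.
  by rewrite -size_poly_eq0 /P size_XnsubC.
have [s sP] := closed_field_poly_normal P.
pose F (a : {ffun G -> 'I_(size s)}) : {ffun G -> R[i]} := [ffun u => s`_(a u)].
apply: (@sub_finite_set _ _ (range F)); last exact/finite_image/finite_finset.
move=> chi [chi1 chiM].
have chiX u n : chi (u ^+ n)%g = chi u ^+ n.
  by elim: n => [|n IH]; rewrite ?expg0 ?expr0// expgS exprS chiM IH.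
have ins u : chi u \in s.
  have : root P (chi u).
    rewrite /root /P !hornerE -chiX -cardsT (expg_cardG (finset.in_setT u)).
    by rewrite chi1 subrr.
  by rewrite sP rootZ ?lead_coef_eq0// root_prod_XsubC.
have idx u : (index (chi u) s < size s)%N by rewrite index_mem.
exists [ffun u => Ordinal (idx u)] => //.
by apply/ffunP => u; rewrite !ffunE /= nth_index.
Qed.

(* Extension by zero; only ever evaluated below at n! with n < p, which is a
   unit. *)
Definition mulchar_val (R : realType) (p : nat)
    (chi : {ffun {unit 'F_p} -> R[i]}) (x : 'F_p) : R[i] :=
  if insub x is Some u then chi u else 0.

Definition factsum (R : realType) (p : nat) (chi : {ffun {unit 'F_p} -> R[i]})
    (f : {poly 'F_p}) (H N : nat) : R[i] :=
  \sum_(H.+1 <= n < (H + N).+1)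
    mulchar_val chi n`!%:R * addchar R f.[n%:R].

(* [normc] is the complex modulus with values in R rather than in R[i]. The
   finitely supported sum is over a finite set by [finite_mulchars]. *)
Definition factsum_sqsum (R : realType) (p : nat) (f : {poly 'F_p}) (H N : nat) : R :=
  \sum_(chi \in @mulchars R p) Normc.normc (factsum chi f H N) ^+ 2.

(* {poly_d.+1 'F_p} is the finite type of polynomials of degree at most d; the
   condition on the size keeps those of degree exactly d. The default 0 is
   immaterial: such polynomials exist and [factsum_sqsum] is nonnegative. *)
Definition max_factsum_sqsum (R : realType) (p d H N : nat) : R :=
  \big[Num.max/0]_(f : {poly_d.+1 'F_p} | size f == d.+1) factsum_sqsum R f H N.

(* Main.v *)
(* Bessel's inequality for the multiplicative characters, which are orthogonal
   functions on F_p^*, bounds the mean square by p times the number of pairs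
   (m, n) in the interval with n! = m! in F_p; the additive weights have modulus
   one and play no role. For k > 0 at most k of these pairs have n = m + k, since
   m is then a root of (X + 1) ... (X + k) - 1. Cutting the interval into about
   sqrt N blocks of length about sqrt N and applying Cauchy-Schwarz over the
   blocks leaves only pairs at distance at most sqrt N, and these number O(N). *)

Require Import Defs.
From mathcomp Require Import all_boot all_order all_algebra.
From mathcomp Require Import all_fingroup.
From mathcomp Require Import all_classical all_reals all_analysis.
From mathcomp Require Import complex zify ring.
Import Order.TTheory GRing.Theory Num.Theory.
Local Open Scope nat_scope.

(** * Counting coincidences in a finite sequence *)

Lemma sqr_sum_leq (I : finType) (x : I -> nat) :
  (\sum_i x i) ^ 2 <= #|I| * \sum_i x i ^ 2.
Proof.
(* Both sides become double sums, to be compared through 2 x_i x_j <= x_i^2 + x_j^2. *)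
have -> : (\sum_i x i) ^ 2 = \sum_i \sum_j x i * x j.
  by rewrite expnS expn1 big_distrlr.
rewrite -(leq_pmul2l (isT : 0 < 2)) big_distrr /=.
have -> : 2 * (#|I| * \sum_i x i ^ 2) = \sum_i \sum_j (x i ^ 2 + x j ^ 2).
  under [RHS]eq_bigr do rewrite big_split /= sum_nat_const.
  by rewrite big_split /= -big_distrr /= sum_nat_const mul2n addnn.
apply: leq_sum => i _; rewrite big_distrr; apply: leq_sum => j _ /=.
exact: nat_Cauchy.
Qed.

Lemma sum_sqr_card_fiber (I W : finType) (g : I -> W) :
  \sum_w #|[pred i | g i == w]| ^ 2 = #|[pred q : I * I | g q.1 == g q.2]|.
Proof.
rewrite -sum1_card (partition_big (fun q : I * I => g q.1) predT) //=.
apply: eq_bigr => w _; rewrite expnS expn1 -cardX -sum1_card.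
apply: eq_bigl => -[i j]; rewrite !inE /=.
by apply/andP/andP => -[/eqP-> /eqP->].
Qed.

Section FewCollisions.
Variables (N : nat) (T : finType) (u : nat -> T).
Hypothesis few_collisions : forall k, 0 < k ->
  #|[pred m : 'I_N | (m + k < N) && (u (m + k) == u m)]| <= k.

(** Pairs are sorted by their distance k: the diagonal k = 0 contributes at most N of them, and
    [few_collisions] allows at most k at each distance k > 0. *)
Lemma near_collisions_leq (K : nat) :
  #|[pred q : 'I_N * 'I_N | (u q.1 == u q.2) && (q.1 <= q.2 < q.1 + K)]|
    <= N + \sum_(k < K) k.
Proof.
case: K => [|K].
  by rewrite eq_card0 // => q; rewrite !inE addn0; lia.
pose diff (q : 'I_N * 'I_N) : 'I_K.+1 := inord (q.2 - q.1).
set D := [pred q | _].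
rewrite -sum1_card (partition_big diff predT) //=.
apply: (@leq_trans (\sum_(k < K.+1) (N * (k == ord0) + k))); last first.
  rewrite big_split leq_add2r -big_distrr /=.
  by rewrite (bigD1 ord0) //= big1 ?muln1 // => k /negPf->.
apply: leq_sum => k _; rewrite sum1_card.
(* At a fixed distance a pair is determined by its first entry, so it suffices to count first
   entries. *)
have inj : {in [pred q | (q \in D) && (diff q == k)] &, injective fst}.
  move=> [m n] [m' n']; rewrite !inE /=.
  move=> /andP[/andP[_ h] /eqP e] /andP[/andP[_ h'] /eqP e'] mm'.
  subst m'; congr pair; apply: val_inj => /=.
  by move/(congr1 val): e; move/(congr1 val): e'; rewrite /= /diff !inordK /=; lia.
rewrite -(card_in_image inj).
have [k0|k0] := eqVneq k ord0.
  by rewrite muln1 k0 addn0 -[X in _ <= X](card_ord N) max_card.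
rewrite muln0 add0n; apply: leq_trans (few_collisions k _); last by rewrite lt0n.
apply/subset_leq_card/fintype.subsetP => _ /fintype.imageP[[m n] mn ->].
move: mn; rewrite !inE /= => /andP[/andP[/eqP e h] /eqP kE].
move/(congr1 val): kE; rewrite /= /diff inordK /=; last lia.
move=> <-; have -> : m + (n - m) = n by lia.
by rewrite ltn_ord e eqxx.
Qed.

(** Each fibre splits into N/K + 1 pieces, one per block of length K, and Cauchy-Schwarz costs that
    factor. Entries of one block are less than K apart, so [near_collisions_leq], used once for each
    order of the pair, gives 2 (N + K (K - 1) / 2) <= 2 N + K^2. *)
Lemma sum_sqr_card_fiber_leq (K : nat) : 0 < K ->
  \sum_v #|[pred n : 'I_N | u n == v]| ^ 2 <= (N %/ K).+1 * (2 * N + K ^ 2).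
Proof.
move=> K0; pose blk (n : 'I_N) : 'I_(N %/ K).+1 := inord (n %/ K).
have blkE n : blk n = n %/ K :> nat.
  by rewrite inordK // ltnS leq_div2r // ltnW.
pose g (n : 'I_N) := (u n, blk n).
apply: (@leq_trans ((N %/ K).+1 * \sum_w #|[pred n | g n == w]| ^ 2)).
  rewrite -(pair_bigA _ (fun v q => #|[pred n | g n == (v, q)]| ^ 2)) /=.
  rewrite big_distrr /=; apply: leq_sum => v _.
  rewrite -[X in X * _](card_ord (N %/ K).+1).
  apply: leq_trans (sqr_sum_leq _ _); apply: eq_leq; congr (_ ^ 2).
  rewrite -sum1_card (partition_big blk predT) //=.
  by apply: eq_bigr => q _; rewrite -sum1_card; apply: eq_bigl => n; rewrite !inE.
rewrite leq_mul2l sum_sqr_card_fiber; apply/orP; right.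
pose D := [pred q : 'I_N * 'I_N | (u q.1 == u q.2) && (q.1 <= q.2 < q.1 + K)].
pose D' := [pred q : 'I_N * 'I_N | (q.2, q.1) \in D].
have swap_inj : injective (fun q : 'I_N * 'I_N => (q.2, q.1)).
  by move=> [a b] [c e] [-> ->].
have cD' : #|D'| <= #|D|.
  rewrite -(fintype.card_image swap_inj); apply/subset_leq_card.
  by apply/fintype.subsetP => _ /fintype.imageP[q ? ->].
have cD := near_collisions_leq K.
have sK : 2 * \sum_(k < K) k <= K ^ 2.
  by rewrite -(big_mkord predT id) bin2_sum bin2; nia.
apply: (@leq_trans (#|D| + #|D'|)); last by rewrite -/D in cD; lia.
apply: leq_trans (_ : #|[predU D & D']| <= _); last by rewrite -cardUI leq_addr.
apply/subset_leq_card/fintype.subsetP => -[a b].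
rewrite !inE /= => /eqP[-> /(congr1 val)].
rewrite /= !blkE eqxx /= => e.
have := divn_eq a K; have := divn_eq b K.
have := ltn_pmod a K0; have := ltn_pmod b K0; rewrite e; lia.
Qed.

End FewCollisions.

Local Open Scope ring_scope.

(** * Bessel's inequality *)

(** With y the sum of the c_j phi_j, expanding the nonnegative sum of |g b - y|^2 gives g (g sum
    |b|^2 - sum |c_j|^2). The factor g before b accounts for the [phi j] having square norm g
    instead of 1. *)
Lemma bessel_ineq (C : numClosedFieldType) (I : finType) (J : eqType)
    (s : seq J) (phi : J -> I -> C) (g : C) (b : I -> C) :
  uniq s -> 0 < g ->
  {in s &, forall j k, \sum_i phi j i * (phi k i)^* = if j == k then g else 0} ->
  \sum_(j <- s) `|\sum_i b i * (phi j i)^*| ^+ 2 <= g * \sum_i `|b i| ^+ 2.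
Proof.
move=> us g0 orth; pose c j := \sum_i b i * (phi j i)^*.
pose y i := \sum_(j <- s) c j * phi j i.
have gR : g^* = g by apply/CrealP/gtr0_real.
have by_ : \sum_i b i * (y i)^* = \sum_(j <- s) `|c j| ^+ 2.
  under eq_bigr do rewrite rmorph_sum mulr_sumr.
  rewrite exchange_big; apply: eq_bigr => j _.
  rewrite normCK mulr_suml; apply: eq_bigr => i _.
  by rewrite rmorphM /= mulrCA mulrC.
have yb : \sum_i (b i)^* * y i = \sum_(j <- s) `|c j| ^+ 2.
  rewrite -[RHS]conj_Creal; last first.
    by apply: ger0_real; apply: sumr_ge0 => j _; rewrite exprn_ge0.
  rewrite -by_ rmorph_sum; apply: eq_bigr => i _.
  by rewrite rmorphM /= conjCK.
have yy : \sum_i y i * (y i)^* = g * \sum_(j <- s) `|c j| ^+ 2.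
  transitivity (\sum_(j <- s) \sum_(k <- s)
      c j * (c k)^* * \sum_i phi j i * (phi k i)^*).
    under eq_bigr do rewrite rmorph_sum big_distrlr /=.
    rewrite exchange_big; apply: eq_bigr => j _.
    rewrite exchange_big; apply: eq_bigr => k _.
    rewrite mulr_sumr; apply: eq_bigr => i _.
    by rewrite rmorphM /= mulrACA.
  rewrite mulr_sumr !big_seq; apply: eq_bigr => j js.
  rewrite (bigD1_seq j) //=.
  rewrite [X in _ + X]big_seq_cond [X in _ + X]big1 ?addr0 => [|k /andP[ks kj]].
    by rewrite orth // eqxx normCK mulrC.
  by rewrite orth // eq_sym (negPf kj) mulr0.
have : 0 <= \sum_i `|g * b i - y i| ^+ 2.
  by apply: sumr_ge0 => i _; rewrite exprn_ge0.
have -> : \sum_i `|g * b i - y i| ^+ 2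
    = g * (g * \sum_i `|b i| ^+ 2 - \sum_(j <- s) `|c j| ^+ 2).
  transitivity (g ^+ 2 * (\sum_i `|b i| ^+ 2) - g * (\sum_i b i * (y i)^*)
                - g * (\sum_i (b i)^* * y i) + \sum_i y i * (y i)^*).
    rewrite !mulr_sumr -!sumrB -big_split; apply: eq_bigr => i _ /=.
    by rewrite !normCK rmorphB rmorphM /= gR; ring.
  by rewrite by_ yb yy; ring.
by rewrite pmulr_rge0 // subr_ge0.
Qed.

Lemma normc_norm (R : rcfType) (z : R[i]) : (Normc.normc z)%:C%C = `|z|.
Proof. by case: z. Qed.

Lemma norm_addchar (R : realType) (p : nat) (z : 'F_p) : `|addchar R z| = 1.
Proof. by rewrite -normc_norm /addchar /= cos2Dsin2 sqrtr1. Qed.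

(** * Orthogonality of multiplicative characters *)

Section Characters.
Variables (R : realType) (p : nat).
Implicit Types chi psi : {ffun {unit 'F_p} -> R[i]}.

(** As u has finite order, its image is a root of unity and so has modulus 1. *)
Lemma mulchar_conj chi u : mulchars chi -> chi u * (chi u)^* = 1.
Proof.
move=> [chi1 chiM].
have chiX n : chi (u ^+ n)%g = chi u ^+ n.
  by elim: n => [|n IH]; rewrite ?expg0 ?expr0 // expgS exprS chiM IH.
have o0 : (0 < #[u]%g)%N by exact: order_gt0.
have : `|chi u| ^+ #[u]%g == 1 by rewrite -normrX -chiX expg_order chi1 normr1.
by rewrite pexpr_eq1 // => /eqP e; rewrite -normCK e expr1n.
Qed.

(** If the characters differ at v, replacing u by v u multiplies the sum by a factor other than 1,
    so the sum vanishes. *)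
Lemma mulchar_orthogonal chi psi : mulchars chi -> mulchars psi ->
  \sum_u chi u * (psi u)^* = if chi == psi then #|{: {unit 'F_p}}|%:R else 0.
Proof.
move=> hchi hpsi; have [_ chiM] := hchi; have [_ psiM] := hpsi.
have [<-|ne] := eqVneq chi psi.
  by under eq_bigr do rewrite mulchar_conj //; rewrite sumr_const.
have [v chipsi] : exists v, chi v != psi v.
  apply/existsP; rewrite -negb_forall; apply: contra ne => /forallP e.
  by apply/eqP/ffunP => v; apply/eqP.
have v1 : chi v * (psi v)^* != 1.
  apply: contra chipsi => /eqP e; apply/eqP.
  by rewrite -[LHS]mulr1 -(mulchar_conj _ v hpsi) mulrCA e mulr1.
set S := \sum_u _.
have SE : chi v * (psi v)^* * S = S.
  rewrite mulr_sumr [RHS](reindex_inj (mulgI v)); apply: eq_bigr => u _.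
  by rewrite chiM psiM rmorphM /= mulrACA.
apply/eqP; move/eqP: SE; rewrite -subr_eq0 -{2}[S]mul1r -mulrBl mulf_eq0 subr_eq0.
by rewrite (negPf v1).
Qed.

Lemma mulchar_bessel (b : {unit 'F_p} -> R[i]) :
  \sum_(chi <- finmap.enum_fset (fset_set (@mulchars R p)))
      `|\sum_u b u * chi u| ^+ 2
    <= #|{: {unit 'F_p}}|%:R * \sum_u `|b u| ^+ 2.
Proof.
have G0 : (0 < #|{: {unit 'F_p}}|)%N by apply/card_gt0P; exists 1%g.
(* [bessel_ineq] conjugates its family, so the conjugate characters are fed to it. *)
have := @bessel_ineq R[i] {unit 'F_p} {ffun {unit 'F_p} -> R[i]}
  (finmap.enum_fset (fset_set (@mulchars R p)))
  (fun chi u => (chi u)^*) #|{: {unit 'F_p}}|%:R b (finmap.fset_uniq _).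
rewrite ltr0n G0 => /(_ isT) bes.
under eq_bigr do under eq_bigr do rewrite -[X in _ * X]conjCK.
apply: bes => chi psi; rewrite !in_fset_set; try exact: finite_mulchars.
rewrite !inE => hchi hpsi; rewrite eq_sym -mulchar_orthogonal //.
by apply: eq_bigr => u _; rewrite conjCK mulrC.
Qed.

End Characters.

(** * Factorials modulo p *)

Section FactorialUnits.
Variables (p : nat) (p_pr : prime p).

Lemma natr_Fp_eq0 (n : nat) : (n%:R == 0 :> 'F_p) = (p %| n)%N.
Proof. by rewrite (dvdn_pcharf (pchar_Fp p_pr)). Qed.

Lemma fact_Fp_neq0 (n : nat) : (n < p)%N -> n`!%:R != 0 :> 'F_p.
Proof.
elim: n => [|n IH] np; first by rewrite fact0 oner_eq0.
rewrite factS natrM mulf_neq0 ?IH //; last exact: ltnW.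
by rewrite natr_Fp_eq0 gtnNdvd.
Qed.

Lemma natr_Fp_inj : {in [pred n | (n < p)%N] &, injective (fun n => n%:R : 'F_p)}.
Proof.
move=> m n; rewrite !inE => mp np /(congr1 (@nat_of_ord _)).
by rewrite /= !val_Fp_nat // !modn_small.
Qed.

(** With Q = (X + 1) ... (X + k), the factorial of a + m + k is (a + m)! Q(a + m). Since (a + m)! is
    invertible, a collision makes a + m a root of Q - 1, of degree k because k > 0. The bound a + N
    <= p keeps the residues a + m distinct. *)
Lemma card_fact_collisions (a N k : nat) : (a + N <= p)%N -> (0 < k)%N ->
  (#|[pred m : 'I_N | (m + k < N) &&
     ((a + (m + k))`!%:R == (a + m)`!%:R :> 'F_p)]| <= k)%N.
Proof.
move=> aNp k0; set A := [pred m | _].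
pose Q : {poly 'F_p} := \prod_(i < k) ('X - (- i.+1%:R)%:P).
have sQ : size Q = k.+1 by rewrite /Q size_prod_XsubC /index_enum -enumT size_enum_ord.
have sP : size (Q - 1) = k.+1.
  by rewrite size_polyDl // size_polyN size_poly1 sQ.
have factE m : (a + (m + k))`!%:R = (a + m)`!%:R * Q.[(a + m)%:R] :> 'F_p.
  rewrite /Q horner_prod; elim: (k) => [|j IH]; first by rewrite big_ord0 mulr1 addn0.
  rewrite big_ord_recr /= mulrA !addnS factS natrM mulrC -IH; congr (_ * _).
  by rewrite hornerXsubC opprK -natrD addnS addnA.
pose rs : seq 'F_p := [seq (a + nat_of_ord m)%:R | m <- enum A].
have := @max_poly_roots _ (Q - 1) rs.
rewrite sP /rs size_map -cardE ltnS => -> //.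
- by rewrite -size_poly_eq0 sP.
- apply/allP => x /mapP[m]; rewrite mem_enum => /andP[mk /eqP e] ->.
  rewrite /root !hornerE subr_eq0; apply/eqP.
  apply: (@mulfI _ (a + m)`!%:R); first by apply: fact_Fp_neq0; have := ltn_ord m; lia.
  by rewrite mulr1 -factE.
- rewrite map_inj_in_uniq ?enum_uniq // => m n _ _ /natr_Fp_inj e.
  apply: val_inj => /=; apply: (@addnI a); apply: e; rewrite inE.
    by have := ltn_ord m; lia.
  by have := ltn_ord n; lia.
Qed.

Lemma card_units_Fp_leq : (#|{: {unit 'F_p}}| <= p)%N.
Proof.
rewrite -[X in (_ <= X)%N](card_Fp p_pr) -(fintype.card_image (@val_inj _ _ {unit 'F_p})).
exact: max_card.
Qed.

End FactorialUnits.

(** * The mean square estimate *)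

(** Grouping terms by the value v of n! writes the sum as that of b_v chi(v), where |b_v| is at most
    the size of the fibre over v. Bessel then leaves the squares of the fibre sizes. *)
Lemma factsum_sqsum_leq (R : realType) (p H N K : nat) (f : {poly 'F_p}) :
  prime p -> (H + N < p)%N -> (0 < K)%N ->
  factsum_sqsum R f H N <= (p * ((N %/ K).+1 * (2 * N + K ^ 2)))%:R.
Proof.
move=> p_pr HNp K0.
(* Index n stands for H + 1 + n. For n < N this is at most H + N < p, so the default 1 is never
   taken there. *)
pose u n : {unit 'F_p} := insubd (1%g : {unit 'F_p}) ((H.+1 + n)`!%:R : 'F_p).
have uE n : (n < N)%N -> val (u n) = (H.+1 + n)`!%:R.
  by move=> nN; rewrite insubdK // unfold_in /= unitfE fact_Fp_neq0 //; lia.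
have few k : (0 < k)%N ->
    (#|[pred m : 'I_N | (m + k < N) && (u (m + k) == u m)]| <= k)%N.
  move=> k0; apply: leq_trans (@card_fact_collisions p p_pr H.+1 N k _ k0); last by lia.
  apply/subset_leq_card/fintype.subsetP => m; rewrite !inE => /andP[mk /eqP e].
  by rewrite mk -!uE ?e ?eqxx.
have collisions := sum_sqr_card_fiber_leq _ _ _ few _ K0.
pose a (n : nat) := addchar R f.[(H.+1 + n)%:R].
pose b v := \sum_(n < N | u n == v) a n.
have sumE chi : factsum chi f H N = \sum_v b v * chi v.
  rewrite /factsum -{1}[H.+1]add0n big_addn.
  have -> : ((H + N).+1 - H.+1 = N)%N by lia.
  rewrite big_mkord (partition_big (fun n : 'I_N => u n) predT) //=.
  apply: eq_bigr => v _; rewrite mulr_suml; apply: eq_bigr => n /eqP <-.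
  rewrite mulrC /a addnC; congr (_ * _).
  by rewrite /mulchar_val -uE // valK.
have normb v : `|b v| <= #|[pred n : 'I_N | u n == v]|%:R.
  apply: le_trans (ler_norm_sum _ _ _) _.
  by under eq_bigr do rewrite norm_addchar; rewrite sumr_const.
rewrite -lecR /factsum_sqsum fsbig_finite; last exact: finite_mulchars.
rewrite rmorph_sum /=.
under eq_bigr do rewrite rmorphXn /= normc_norm sumE.
apply: le_trans (mulchar_bessel _ _ _) _.
rewrite rmorph_nat natrM; apply: ler_pM; rewrite ?ler_nat ?card_units_Fp_leq //.
  by apply: sumr_ge0 => v _; rewrite exprn_ge0.
apply: (@le_trans _ _ (\sum_v #|[pred n : 'I_N | u n == v]| ^ 2)%:R); last by rewrite ler_nat.
rewrite natr_sum; apply: ler_sum => v _.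
by rewrite natrX lerXn2r // nnegrE.
Qed.

Theorem theorem4 (R : realType) (d : nat) :
  exists C : R, 0 < C /\
    forall p H N : nat, prime p -> odd p ->
      (H < H + N)%N -> (H + N < p)%N ->
      max_factsum_sqsum R p d H N <= C * (p%:R * N%:R `^ (3 / 2)).
Proof.
exists 12; split=> // p H N p_pr _ HN HNp.
have N0 : (0 < N)%N by lia.
have [K [K0 KN NK]] : exists K, [/\ (0 < K)%N, (K ^ 2 <= N)%N & (N < K.+1 ^ 2)%N].
  have ex : exists K, (K ^ 2 <= N)%N by exists 0%N.
  have bd K : (K ^ 2 <= N)%N -> (K <= N)%N by nia.
  case: (ex_maxnP ex bd) => K KN Kmax; exists K; split=> //; first exact: Kmax.
  by rewrite ltnNge; apply/negP => /Kmax; rewrite ltnn.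
(* As K is the integer part of sqrt N, N/K <= K + 2, so the first factor is at most K + 3 <= 4 K;
   the second is at most 3 N. Hence the constant 12. *)
have blocks : ((N %/ K).+1 * (2 * N + K ^ 2) <= 12 * (N * K))%N.
  have : (N %/ K <= K + 2)%N by rewrite -ltnS ltn_divLR //; nia.
  nia.
apply: bigmax_le => [|f _].
  by rewrite !mulr_ge0 ?powR_ge0.
apply: le_trans (factsum_sqsum_leq R _ _ _ _ f p_pr HNp K0) _.
rewrite natrM mulrCA ler_wpM2l //.
apply: (@le_trans _ _ (12 * (N * K))%:R); first by rewrite ler_nat.
rewrite natrM ler_wpM2l // natrM.
(* It remains to write N^(3/2) as N sqrt N and use K <= sqrt N. *)
have -> : 3 / 2 = 1 + 2^-1 :> R by rewrite -[3]/(2 + 1)%:R natrD mulrDl divff ?mul1r ?pnatr_eq0.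
rewrite powRD ?powRr1 ?powR12_sqrt //; last by rewrite pnatr_eq0 -lt0n N0 implybT.
by rewrite ler_wpM2l // -(ger0_norm (ler0n R K)) -sqrtr_sqr ler_wsqrtr // -natrX ler_nat.
Qed.
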